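(* If $G$ is a connected, nonregular, nonbipartite graph of order $n$, diameter $D$, and maximum degree $\Delta$, then $$\Delta+\mu_{\min}(G)>\frac{1}{n(D+1)}+\frac{1}{\mu^{2D}(G)\,n}.$$
   Context: Graphs are finite, simple and undirected, with nonempty vertex set; the order of a graph is its number of vertices. $\mu(G)$ and $\mu_{\min}(G)$ denote the largest and the smallest eigenvalues of the adjacency matrix of $G$, and $\mu^{2D}(G)=(\mu(G))^{2D}$. The diameter is the maximum over pairs of vertices of the length of a shortest path joining them. *)

(* Defs.v *)
From mathcomp Require Import all_boot all_order all_algebra.
From mathcomp Require Import boolp classical_sets reals.

Set Implicit Arguments.
Unset Strict Implicit.
Unset Printing Implicit Defensive.

Import Order.TTheory GRing.Theory Num.Theory.

Record sgraph := SGraph {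
  vertex :> finType;
  adj : rel vertex;
  adj_sym : symmetric adj;
  adj_irr : irreflexive adj;
  vertex_gt0 : 0 < #|vertex|
}.

Section Graph.
Variable G : sgraph.

Definition degree (x : G) : nat := #|[set y : G | adj x y]|.

Definition max_degree : nat := \max_(x : G) degree x.

Definition regular_graph : Prop := exists d, forall x : G, degree x = d.

Definition bipartite_graph : Prop :=
  exists A : {set G}, forall x y : G, adj x y -> (x \in A) != (y \in A).

Definition is_path (x y : G) (p : seq G) : bool :=
  [&& path (@adj G) x p, last x p == y & uniq (x :: p)].

Definition connected_graph : Prop := forall x y : G, exists p, is_path x y p.

(* A path has at most #|G| - 1 edges, so the range k < #|G| covers all lengths;
   the value is #|G| when no path joins x to y. *)
Definition dist (x y : G) : nat :=
  \big[minn/#|G|]_(k < #|G| | [exists p : k.-tuple G, is_path x y p]) k.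

Definition diameter : nat := \max_(x : G) \max_(y : G) dist x y.

End Graph.

Local Open Scope ring_scope.
Local Open Scope classical_set_scope.

Section Spectrum.
Variables (R : realType) (G : sgraph).

Definition adj_mx : 'M[R]_#|G| :=
  \matrix_(i, j) (adj (enum_val i : G) (enum_val j))%:R.

(* The spectrum of a real symmetric matrix is finite and nonempty, so sup and
   inf are its maximum and its minimum. *)
Definition spectrum : set R := [set a | eigenvalue adj_mx a].

Definition mu_max : R := sup spectrum.

Definition mu_min : R := inf spectrum.

End Spectrum.

(* Main.v *)
Require Import Defs.
From mathcomp Require Import all_boot all_order all_algebra.
From mathcomp Require Import boolp classical_sets reals.
From mathcomp Require Import topology normedtype derive.
From mathcomp Require Import ring lra.

Set Implicit Arguments.
Unset Strict Implicit.
Unset Printing Implicit Defensive.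

Import Order.TTheory GRing.Theory Num.Theory.
Import numFieldNormedType.Exports.
Local Open Scope ring_scope.

(** Write [Delta], [mu], [n], [D] for the maximum degree, the largest eigenvalue, the
    order and the diameter. The sum [Delta + mu_min] splits into two gaps,
    [Delta - mu] and [mu + mu_min], and each is bounded below by one of the two terms.
    Both bounds rest on a positive eigenvector [x] (lemma [perron]): the absolute
    value of a maximiser of the adjacency form on the unit sphere again maximises
    it, a maximiser is an eigenvector, and connectedness spreads positivity. Any
    eigenvalue with a positive eigenvector is [mu] (lemma [mu_maxE]).

    First gap (lemma [max_gap]). Summing by parts,
    [(Delta - mu) * \sum_i x_i^2] is the sum of the nonnegative terms
    [(Delta - d_i) * x_i^2] and of [(x_i - x_j)^2] over the edges. Join a vertex [u] of
    degree less than [Delta] to a vertex [w] where [x] is largest by a path of at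
    most [D] edges. By Cauchy-Schwarz the term of [u] and the edges of this path
    contribute at least [x_w^2 / (D + 1)], and [n * x_w^2 > \sum_i x_i^2] because [x] is
    constant only when the graph is regular.

    Second gap (lemma [min_gap]). Let [y] be an eigenvector for the eigenvalue [a],
    scaled so that [|y| <= x] with [y_p = x_p] for some [p], and put [b = mu + a]. The
    vectors [x - y] and [x + y] are nonnegative, and the adjacency operator
    exchanges them up to the factor [mu] and the error [b * y]. So if [b] is small,
    the vanishing of [x - y] at [p] forces [x - y] or [x + y], according to the parity
    of [l], to be small at the end of every walk of length [l] from [p]: the bound
    grows like [b * x_w * (mu^l - 1) / (mu - 1)]. In a nonbipartite graph some edge
    has both ends at the same distance from [p], whence two walks from [p] to [w] of
    lengths [l <= 2 * D] and [l + 1]. At [w] the two vectors add up to [2 * x_w], so [b]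
    is at least [2 * (mu - 1) / ((1 + mu) * mu^(2D) - 2)]. This exceeds [1 / (mu^(2D) * n)]
    as soon as [n >= 3] and [mu^2 >= 2], which hold since [n > Delta >= 2] and
    [mu^2 >= Delta]. *)

(** * Distances *)

Lemma vertex_inhabited (G : sgraph) : inhabited G.
Proof. by have /card_gt0P[i _] := vertex_gt0 G. Qed.

Lemma path_size_lt (G : sgraph) (x y : G) p : is_path x y p -> (size p < #|G|)%N.
Proof.
move=> /and3P[_ _ u]; rewrite -[(size p).+1]/(size (x :: p)).
by rewrite -(card_uniqP u); apply: max_card.
Qed.

Lemma dist_le_path (G : sgraph) (x y : G) p :
  is_path x y p -> (dist x y <= size p)%N.
Proof.
move=> xyp; have ltp := path_size_lt xyp.
have ex : [exists q : (Ordinal ltp).-tuple G, is_path x y q].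
  by apply/existsP; exists (in_tuple p).
rewrite /dist; exact: (@bigmin_le_cond _ _ _ _ (Ordinal ltp)
  (fun k => [exists q : k.-tuple G, is_path x y q]) (fun k => val k) ex).
Qed.

Lemma dist_le_walk (G : sgraph) (x : G) p :
  path (@adj G) x p -> (dist x (last x p) <= size p)%N.
Proof.
move=> xp; have [p' xp' up' sub] := shortenP xp.
have /leq_trans : (dist x (last x p') <= size p')%N.
  by apply: dist_le_path; rewrite /is_path xp' eqxx up'.
by apply; case/andP: up' => _ up'; apply: (uniq_leq_size up' sub).
Qed.

Lemma geodesicP (G : sgraph) (x y : G) : connected_graph G ->
  exists2 p, is_path x y p & size p = dist x y.
Proof.
move=> conn; have [p xyp] := conn x y.
have := leq_ltn_trans (dist_le_path xyp) (path_size_lt xyp).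
rewrite /dist; apply: (big_rec (fun m => (m < #|G|)%N ->
  exists2 p, is_path x y p & size p = m)) => [|k m /existsP[q xyq] IH]; first by rewrite ltnn.
have [_ _|_] := ltnP k m; last exact: IH.
by exists q => //; rewrite size_tuple.
Qed.

Lemma dist_le_diameter (G : sgraph) (x y : G) : (dist x y <= diameter G)%N.
Proof.
rewrite /diameter.
apply: leq_trans (leq_bigmax (F := fun x : G => \max_y dist x y) x).
exact: (leq_bigmax (F := fun y : G => dist x y) y).
Qed.

Lemma dist_step (G : sgraph) (x u v : G) : connected_graph G ->
  adj u v -> (dist x v <= (dist x u).+1)%N.
Proof.
move=> conn uv; have [p /and3P[xp /eqP lp _] <-] := geodesicP x u conn.
have /dist_le_walk : path (@adj G) x (rcons p v) by rewrite rcons_path xp lp.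
by rewrite last_rcons size_rcons.
Qed.

(** The parity of the distance from [x] is a proper 2-colouring unless some edge
    stays inside a distance level. *)
Lemma nonbipartite_level_edge (G : sgraph) (x : G) : connected_graph G ->
  ~ bipartite_graph G -> exists u v : G, adj u v /\ dist x u = dist x v.
Proof.
move=> conn nbip; apply: contrapT => no; apply: nbip.
exists [set u | odd (dist x u)]%SET => u v uv; rewrite !inE.
have := dist_step x conn uv; have vu : adj v u by rewrite adj_sym.
have := dist_step x conn vu.
have : dist x u != dist x v by apply/eqP => e; apply: no; exists u, v.
move: (dist x u) (dist x v) => a b; rewrite neq_ltn => /orP[lt_ab _ le_ba|lt_ba le_ab _].
  have -> : b = a.+1 by apply/eqP; rewrite eqn_leq lt_ab le_ba.
  by rewrite /=; case: odd.
have -> : a = b.+1 by apply/eqP; rewrite eqn_leq lt_ba le_ab.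
by rewrite /=; case: odd.
Qed.

(** * The adjacency operator on vertex functions *)

(** The product with [adj_mx], free of the numbering of the vertices. *)
Definition nbr_sum (R : realType) (G : sgraph) (f : G -> R) (i : G) : R :=
  \sum_(j | adj i j) f j.

Lemma nbr_sumZ (R : realType) (G : sgraph) (c : R) (f : G -> R) i :
  nbr_sum (fun j : G => c * f j) i = c * nbr_sum f i.
Proof. by rewrite /nbr_sum mulr_sumr. Qed.

Lemma nbr_sum_comm (R : realType) (G : sgraph) (f g : G -> R) :
  \sum_i f i * nbr_sum g i = \sum_i g i * nbr_sum f i.
Proof.
under eq_bigr do rewrite /nbr_sum mulr_sumr big_mkcond.
rewrite exchange_big /=; apply: eq_bigr => j _.
rewrite /nbr_sum mulr_sumr [RHS]big_mkcond; apply: eq_bigr => i _.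
by rewrite adj_sym; case: adj; rewrite // mulrC.
Qed.

Lemma spectrumP (R : realType) (G : sgraph) (a : R) :
  @spectrum R G a <->
  exists2 f : G -> R, (forall i, nbr_sum f i = a * f i) & exists i, f i != 0.
Proof.
split=> [/eigenvalueP[v va v0]|[f fa [i fi]]].
  exists (fun i => v 0 (enum_rank i)).
    move=> i; have /rowP/(_ (enum_rank i)) := va; rewrite !mxE => <-.
    rewrite [RHS](reindex enum_rank) /=; last exact: onW_bij (enum_rank_bij _).
    rewrite /nbr_sum big_mkcond /=; apply: eq_bigr => j _.
    rewrite mxE !enum_rankK adj_sym; case: adj; by rewrite ?mulr1 ?mulr0.
  have /rV0Pn[k vk] := v0.
  by exists (enum_val k); rewrite enum_valK.
apply/eigenvalueP; exists (\row_k f (enum_val k)).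
  apply/rowP => k; rewrite !mxE -fa /nbr_sum.
  rewrite [LHS](reindex enum_rank) /=; last exact: onW_bij (enum_rank_bij _).
  rewrite [RHS]big_mkcond /=; apply: eq_bigr => j _.
  rewrite !mxE !enum_rankK adj_sym; case: adj; by rewrite ?mulr1 ?mulr0.
apply/rV0Pn; exists (enum_rank i); by rewrite mxE enum_rankK.
Qed.

(** * A positive eigenvector *)

Definition adj_form (R : realType) (G : sgraph) (f : G -> R) : R :=
  \sum_i f i * nbr_sum f i.

Lemma adj_formZ (R : realType) (G : sgraph) (c : R) (f : G -> R) :
  adj_form (fun i : G => c * f i) = c ^+ 2 * adj_form f.
Proof.
rewrite /adj_form mulr_sumr; apply: eq_bigr => i _.
by rewrite nbr_sumZ; ring.
Qed.

Lemma compact_sphere (R : realType) n :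
  compact [set v : 'rV[R]_n | \sum_i v 0 i ^+ 2 = 1]%classic.
Proof.
apply: (@subclosed_compact _ _
  [set v : 'rV[R]_n | forall i, `[-1, 1]%classic (v ord0 i)]%classic).
- have sum_cont : continuous (fun v : 'rV[R]_n => \sum_i v 0 i ^+ 2).
    apply: (@continuous_big _ _ +%R 0 xpredT (@add_continuous R)) => i _ v.
    by apply: (@continuousM _ _ (fun w : 'rV[R]_n => w 0 i) (fun w => w 0 i));
      exact: coord_continuous.
  apply: (@preimage_closed _ _ (fun v : 'rV[R]_n => \sum_i v 0 i ^+ 2) [set 1]%classic).
    by move=> v _; exact: sum_cont.
  exact: closed_eq.
- exact: (@rV_compact R n (fun=> `[-1, 1]%classic) (fun=> @segment_compact _ _ _)).
- move=> v /= v1 i; rewrite /= in_itv /= -ler_norml -(@expr_le1 _ 2) ?real_normK ?num_real //.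
  by rewrite -v1 (bigD1 i) //= lerDl sumr_ge0 // => j _; rewrite sqr_ge0.
Qed.

(** The factor [\sum_i f i ^+ 2] makes the bound homogeneous, so that it applies to
    perturbations of the maximiser without renormalising them. *)
Lemma adj_form_max (R : realType) (G : sgraph) : exists2 c : G -> R,
  \sum_i c i ^+ 2 = 1 & forall f : G -> R, adj_form f <= adj_form c * \sum_i f i ^+ 2.
Proof.
pose tofun (v : 'rV[R]_#|G|) (i : G) := v 0 (enum_rank i).
have sumE v : \sum_(i : G) tofun v i ^+ 2 = \sum_k v 0 k ^+ 2.
  by rewrite [RHS](reindex enum_rank) //; exact: onW_bij (enum_rank_bij _).
have [] := @EVT_max_rV R #|G| (fun v => adj_form (tofun v))
  [set v : 'rV[R]_#|G| | \sum_i v 0 i ^+ 2 = 1]%classic.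
- have [i0] := vertex_inhabited G.
  exists (\row_k (k == enum_rank i0)%:R) => /=.
  rewrite (bigD1 (enum_rank i0)) //= mxE eqxx expr1n big1 ?addr0 // => k /negPf k0.
  by rewrite mxE k0 expr0n.
- exact: compact_sphere.
- apply: continuous_subspaceT.
  apply: (@continuous_big _ _ +%R 0 xpredT (@add_continuous R)) => i _ v.
  apply: continuousM; first exact: coord_continuous.
  move: v; apply: (@continuous_big _ _ +%R 0 _ (@add_continuous R)) => j _.
  exact: coord_continuous.
move=> c; rewrite inE /= => c1 cmax; exists (tofun c); first by rewrite sumE.
move=> f; set s := \sum_i f i ^+ 2.
have s_ge0 : 0 <= s by apply: sumr_ge0 => i _; exact: sqr_ge0.
have [s0|s_neq0] := eqVneq s 0.
  have f0 i : f i = 0.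
    apply/eqP; rewrite -sqrf_eq0; move/eqP: s0; rewrite psumr_eq0; last by move=> j _; exact: sqr_ge0.
    by move=> /allP/(_ i (mem_index_enum _)).
  by rewrite s0 mulr0 /adj_form big1 // => i _; rewrite f0 mul0r.
have s_gt0 : 0 < s by rewrite lt_def s_neq0.
pose r := Num.sqrt s; have r2 : r ^+ 2 = s by rewrite sqr_sqrtr.
have r_neq0 : r != 0 by rewrite sqrtr_eq0 -ltNge.
pose v : 'rV[R]_#|G| := \row_k (r^-1 * f (enum_val k)).
have vE i : tofun v i = r^-1 * f i by rewrite /tofun mxE enum_rankK.
have /cmax : v \in [set v : 'rV[R]_#|G| | \sum_i v 0 i ^+ 2 = 1]%classic.
  rewrite inE /= -sumE; under eq_bigr do rewrite vE exprMn.
  by rewrite -mulr_sumr -/s exprVn r2 mulVf.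
have -> : adj_form (tofun v) = s^-1 * adj_form f.
  by rewrite (_ : tofun v = fun i : G => r^-1 * f i) ?adj_formZ ?exprVn ?r2 //; apply/funext.
by rewrite ler_pdivrMl // mulrC.
Qed.

(** With [mu] the maximum of the form on the unit sphere and [x] the absolute value of
    a maximiser, the form at [x + t d] is at most [mu * |x + t d|^2] for every [t]; the
    linear terms in [t] must agree, and for [d] a coordinate vector this is the
    eigenvalue equation at one vertex. A zero of the nonnegative [x] propagates to its
    neighbours through that equation, hence to all vertices. *)
Lemma perron (R : realType) (G : sgraph) : connected_graph G ->
  exists (mu : R) (x : G -> R), (forall i, 0 < x i) /\ forall i, nbr_sum x i = mu * x i.
Proof.
move=> conn; have [c c1 cmax] := adj_form_max R G; pose mu := adj_form c.
pose x i := `|c i|.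
have x_ge0 i : 0 <= x i by exact: normr_ge0.
have x1 : \sum_i x i ^+ 2 = 1.
  by rewrite -c1; apply: eq_bigr => i _; rewrite real_normK ?num_real.
have muE : adj_form x = mu.
  apply/eqP; rewrite eq_le; apply/andP; split.
    by have := cmax x; rewrite x1 mulr1.
  apply: ler_sum => i _; rewrite /nbr_sum !mulr_sumr; apply: ler_sum => j _.
  by rewrite -normrM ler_norm.
have xE i : nbr_sum x i = mu * x i.
  pose d (j : G) : R := (j == i)%:R.
  have dsum (g : G -> R) : \sum_j d j * g j = g i.
    rewrite (bigD1 i) //= /d eqxx mul1r big1 ?addr0 // => j /negPf ->.
    by rewrite mul0r.
  have key t : t * (nbr_sum x i - mu * x i) *+ 2 <= t ^+ 2 * mu.
    have := cmax (fun j : G => x j + t * d j); rewrite -/mu.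
    have -> : \sum_j (x j + t * d j) ^+ 2 = 1 + t * x i *+ 2 + t ^+ 2.
      have d1 : t ^+ 2 = t ^+ 2 * \sum_j d j * d j by rewrite dsum /d eqxx mulr1.
      rewrite [in RHS]d1 -x1 -[in RHS](dsum x).
      rewrite !mulr_sumr -sumrMnl -!big_split; apply: eq_bigr => j _ /=; ring.
    have -> : adj_form (fun j : G => x j + t * d j) = mu + t * nbr_sum x i *+ 2.
      have -> : adj_form (fun j : G => x j + t * d j) =
          adj_form x + t * (\sum_j d j * nbr_sum x j) + t * (\sum_j x j * nbr_sum d j)
          + t ^+ 2 * (\sum_j d j * nbr_sum d j).
        rewrite /adj_form !mulr_sumr -!big_split; apply: eq_bigr => j _ /=.
        rewrite [nbr_sum (fun _ => _) j]big_split /= -mulr_sumr -!/(nbr_sum _ _); ring.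
      rewrite muE [\sum_j x j * _]nbr_sum_comm !dsum.
      have -> : nbr_sum d i = 0.
        apply: big1 => j; rewrite /d; case: eqP => // ->; by rewrite adj_irr.
      ring.
    rewrite mulrBr; lra.
  apply/eqP; rewrite -subr_eq0; apply/eqP; move: (nbr_sum x i - _) key => a key.
  (* the inequality [2 t a <= t^2 mu] is tested at [t = a / (|mu| + 1)] *)
  have m_gt0 : 0 < `|mu| + 1 by rewrite ltr_wpDl.
  have := key (a / (`|mu| + 1)); set t := a / _.
  have at_ : a = t * (`|mu| + 1) by rewrite divfK ?gt_eqF.
  have : t ^+ 2 * mu <= t ^+ 2 * `|mu| by rewrite ler_wpM2l ?sqr_ge0 ?ler_norm.
  have : 0 <= t ^+ 2 * `|mu| by rewrite mulr_ge0 ?sqr_ge0.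
  have t2 := sqr_ge0 t.
  rewrite {1}at_ => h1 h2 h3.
  have : t ^+ 2 <= 0 by move: h1 h2 h3; rewrite !expr2; lra.
  move=> t0; have /eqP : t ^+ 2 = 0 by apply/eqP; rewrite eq_le t0 t2.
  by rewrite sqrf_eq0 => /eqP t00; rewrite at_ t00 mul0r.
exists mu, x; split=> // i.
have spread k p : x k = 0 -> path (@adj G) k p -> x (last k p) = 0.
  elim: p k => //= l p IH k xk /andP[kl /IH]; apply.
  have := xE k; rewrite xk mulr0 => /eqP; rewrite psumr_eq0 //.
  by move=> /allP/(_ l (mem_index_enum _)); rewrite kl => /eqP.
rewrite lt_def x_ge0 andbT; apply/eqP => xi0.
have : \sum_j x j ^+ 2 = 0.
  apply: big1 => j _; have [p /and3P[ip /eqP <- _]] := conn i j.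
  by rewrite (spread i p) // expr0n.
by rewrite x1; apply/eqP; rewrite oner_eq0.
Qed.

(** * Edge energy *)

(** The sum runs over ordered pairs, so each edge inside [s] is counted twice. *)
Definition edge_energy (R : realType) (G : sgraph) (f : G -> R) (s : seq G) : R :=
  \sum_(i <- s) \sum_(j <- s | adj i j) (f i - f j) ^+ 2.

Lemma edge_energy_ge0 (R : realType) (G : sgraph) (f : G -> R) (s : seq G) :
  0 <= edge_energy f s.
Proof. by apply: sumr_ge0 => i _; apply: sumr_ge0 => j _; exact: sqr_ge0. Qed.

Lemma edge_energy_cons (R : realType) (G : sgraph) (f : G -> R) (u v : G) s :
  adj u v -> edge_energy f (v :: s) + (f u - f v) ^+ 2 *+ 2 <= edge_energy f [:: u, v & s].
Proof.
move=> uv; have vu : adj v u by rewrite adj_sym.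
rewrite /edge_energy [leRHS]big_cons.
have head : (f u - f v) ^+ 2 <= \sum_(j <- [:: u, v & s] | adj u j) (f u - f j) ^+ 2.
  rewrite !big_cons adj_irr uv lerDl; apply: sumr_ge0 => j _; exact: sqr_ge0.
pose T i := \sum_(j <- v :: s | adj i j) (f i - f j) ^+ 2.
pose T' i := \sum_(j <- [:: u, v & s] | adj i j) (f i - f j) ^+ 2.
have T'v : T' v = (f v - f u) ^+ 2 + T v by rewrite /T' big_cons vu.
have tail : \sum_(i <- s) T i <= \sum_(i <- s) T' i.
  apply: ler_sum => i _; rewrite /T' big_cons -/(T i); case: ifP => // _.
  by rewrite lerDr sqr_ge0.
set h := \sum_(j <- _ | adj u j) _ in head *.
rewrite -[X in X + _ <= _]/(\sum_(i <- v :: s) T i).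
rewrite -[X in _ <= _ + X]/(\sum_(i <- v :: s) T' i) !big_cons T'v.
by move: head tail; rewrite -[f v - f u]opprB sqrrN mulr2n; lra.
Qed.

(** Cauchy-Schwarz along a path. *)
Lemma path_energy (R : realType) (G : sgraph) (f : G -> R) (u : G) s :
  path (@adj G) u s ->
  (f u - f (last u s)) ^+ 2 *+ 2 <= (size s)%:R * edge_energy f (u :: s).
Proof.
elim: s u => [|v s IH] u /=; first by rewrite subrr expr0n mul0rn mul0r.
move=> /andP[/(edge_energy_cons f s) step /IH {}IH].
move: IH; set a := f v - _ => IH; set b := f u - f v in step *.
have -> : f u - f (last v s) = b + a by rewrite /a /b; ring.
have e_ge0 := edge_energy_ge0 f (v :: s); rewrite -natr1.
move: (edge_energy f (v :: s)) (edge_energy f [:: u, v & s]) step IH e_ge0 => e e' step IH e_ge0.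
have [s0|s_gt0] := posnP (size s).
  move: IH; rewrite s0 mul0r => a0.
  have /eqP : a ^+ 2 = 0 by apply/eqP; rewrite eq_le sqr_ge0 andbT; lra.
  rewrite sqrf_eq0 => /eqP ->; lra.
have k1 : 1 <= (size s)%:R :> R by rewrite ler1n.
move: (size s)%:R k1 IH => k k1 IH.
apply: (@le_trans _ _ ((k + 1) * (e + b ^+ 2 *+ 2))); last by rewrite ler_wpM2l //; lra.
(* the cross term: [2ab <= k b^2 + a^2 / k] *)
have k0 : 0 < k by lra.
have : 0 <= k^-1 * (a - k * b) ^+ 2 by rewrite mulr_ge0 ?sqr_ge0 // invr_ge0 ltW.
have -> : k^-1 * (a - k * b) ^+ 2 = k^-1 * a ^+ 2 - 2 * a * b + k * b ^+ 2.
  by field; rewrite gt_eqF.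
have : k^-1 * (a ^+ 2 *+ 2) <= e by rewrite ler_pdivrMl.
lra.
Qed.

Lemma edge_energy_uniq (R : realType) (G : sgraph) (f : G -> R) (s : seq G) :
  uniq s -> edge_energy f s <= \sum_i \sum_(j | adj i j) (f i - f j) ^+ 2.
Proof.
move=> us; rewrite /edge_energy big_uniq //= [leRHS](bigID (mem s)) /=.
apply: ler_wpDr; first by apply: sumr_ge0 => i _; apply: sumr_ge0 => j _; exact: sqr_ge0.
apply: ler_sum => i _; rewrite big_mkcond big_uniq //= -big_mkcondr /=.
rewrite [leRHS](bigID (mem s)) /=.
rewrite (eq_bigl (fun j => adj i j && (j \in s))) => [|j]; last by rewrite andbC.
by rewrite lerDl; apply: sumr_ge0 => j _; exact: sqr_ge0.
Qed.

(** Both sides are twice the quadratic form of the graph Laplacian. *)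
Lemma degree_energy (R : realType) (G : sgraph) (f : G -> R) :
  \sum_i \sum_(j | adj i j) (f i - f j) ^+ 2
    = (\sum_i ((degree i)%:R * f i ^+ 2 - f i * nbr_sum f i)) *+ 2.
Proof.
have dE (i : G) : (degree i)%:R = nbr_sum (fun _ : G => 1 : R) i.
  by rewrite /degree cardsE -sumr_const.
have swap : \sum_i nbr_sum (fun j : G => f j ^+ 2) i = \sum_i (degree i)%:R * f i ^+ 2.
  transitivity (\sum_(i : G) 1 * nbr_sum (fun j : G => f j ^+ 2) i).
    by apply: eq_bigr => i _; rewrite mul1r.
  by rewrite nbr_sum_comm; apply: eq_bigr => i _; rewrite dE mulrC.
rewrite sumrB mulrnBl mulr2n -{2}swap -big_split -sumrMnl -sumrB.
apply: eq_bigr => i _ /=; rewrite dE /nbr_sum mulr_suml mulr_sumr -sumrMnl -big_split.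
by rewrite -sumrB; apply: eq_bigr => j _ /=; ring.
Qed.

(** * Spectral consequences of a positive eigenvector *)

(** The scaling touches [y] to [x]: it is fixed by the vertex where [|y i| / x i] is
    largest. *)
Lemma touching_scale (R : realType) (G : sgraph) (x y : G -> R) :
  (forall i, 0 < x i) -> (exists i, y i != 0) ->
  exists c, (forall i, `|c * y i| <= x i) /\ exists p, c * y p = x p.
Proof.
move=> x_gt0 [i0 yi0].
have [p _ pmax] := arg_maxP (P := xpredT) (fun i => `|y i| / x i) (erefl (xpredT i0)).
have yp : y p != 0.
  have : 0 < `|y p| / x p.
    by apply: lt_le_trans (pmax i0 isT); rewrite divr_gt0 ?normr_gt0.
  by rewrite pmulr_lgt0 ?invr_gt0 // normr_gt0.
exists (x p / y p); split; last by exists p; rewrite divfK.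
move=> i; have := pmax i isT; rewrite /= ler_pdivrMr // => h.
rewrite normrM normf_div (gtr0_norm (x_gt0 p)) mulrAC ler_pdivrMr ?normr_gt0 //.
suff -> : x i * `|y p| = x p * (`|y p| / x p * x i) by rewrite ler_pM2l.
by field; rewrite gt_eqF.
Qed.

Lemma max_vertex (R : realType) (G : sgraph) (f : G -> R) :
  exists w : G, forall i, f i <= f w.
Proof.
have [i0] := vertex_inhabited G.
have [w _ wmax] := arg_maxP (P := xpredT) f (erefl (xpredT i0)).
by exists w => i; exact: wmax.
Qed.

Section PositiveEigenvector.
Variables (R : realType) (G : sgraph) (mu : R) (x : G -> R).
Hypothesis Gconn : connected_graph G.
Hypothesis x_gt0 : forall i, 0 < x i.
Hypothesis xE : forall i, nbr_sum x i = mu * x i.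

(** The two bounds are the eigenvalue equation of [y] at the vertex where the scaled
    [y] touches [x]. *)
Lemma spectrum_le a : @spectrum R G a -> a <= mu /\ - a <= mu.
Proof.
move=> /spectrumP[y yE /(touching_scale x_gt0)[c [cy [p cyp]]]].
have yp : nbr_sum (fun j : G => c * y j) p = a * x p.
  by rewrite nbr_sumZ yE -cyp mulrCA.
split; rewrite -(ler_pM2r (x_gt0 p)) ?mulNr -yp -xE -?sumrN; apply: ler_sum => j _;
  by have := cy j; rewrite ler_norml => /andP[]; lra.
Qed.

Lemma mu_maxE : mu_max R G = mu.
Proof.
have mu_in : @spectrum R G mu.
  have [w] := vertex_inhabited G; apply/spectrumP; exists x => //.
  by exists w; rewrite gt_eqF.
have ub : ubound (@spectrum R G) mu by move=> a /spectrum_le[].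
apply/eqP; rewrite eq_le; apply/andP; split.
  by apply: ge_sup => //; exists mu.
by apply: ub_le_sup => //; exists mu.
Qed.

(** Walking from [i] to a neighbour and back contributes [degree i * x i] to the
    square of the adjacency operator. *)
Lemma degree_le_sqr (i : G) : (degree i)%:R <= mu ^+ 2.
Proof.
rewrite -(ler_pM2r (x_gt0 i)).
have -> : (degree i)%:R * x i = \sum_(j | adj i j) x i.
  by rewrite /degree cardsE mulr_natl -sumr_const.
rewrite expr2 -mulrA -xE /nbr_sum mulr_sumr; apply: ler_sum => j ij.
have ji : adj j i by rewrite adj_sym.
rewrite -xE /nbr_sum (bigD1 i) //= lerDl.
by apply: sumr_ge0 => k _; exact: ltW.
Qed.

(** At the touching vertex [p] the gap [x - y] vanishes, and one step of a walk turns
    [x - y] into [x + y] and multiplies it by at most [mu], up to an error [b * x w].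
    The sign [(-1) ^+ size s] records which of the two is controlled at the end; the
    factor [mu - 1] clears the denominator of the geometric sum of the errors. *)
Lemma walk_growth (b : R) (w p : G) (y : G -> R) (s : seq G) :
  1 < mu -> (forall i, x i <= x w) -> (forall i, nbr_sum y i = (b - mu) * y i) ->
  (forall i, `|y i| <= x i) -> 0 <= b -> y p = x p -> path (@adj G) p s ->
  (mu - 1) * (x (last p s) - (-1) ^+ size s * y (last p s))
    <= b * x w * (mu ^+ size s - 1).
Proof.
move=> mu1 xw yE yx b0 yp; elim/last_ind: s => [|s v IH].
  by move=> _; rewrite /= !expr0 mul1r yp !subrr !mulr0.
rewrite rcons_path last_rcons size_rcons => /andP[/IH {}IH].
set u := last p s in IH *; set sg := (-1) ^+ size s in IH *; move=> uv.
have sgy i : `|sg * y i| <= x i by rewrite normrM normrX normrN1 expr1n mul1r.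
have e_ge0 i : 0 <= x i + sg * y i.
  by have := sgy i; rewrite ler_norml => /andP[+ _]; lra.
have step : x v + sg * y v <= mu * (x u - sg * y u) + b * x w.
  have : x v + sg * y v <= nbr_sum (fun i : G => x i + sg * y i) u.
    by rewrite /nbr_sum (bigD1 v) //= lerDl; apply: sumr_ge0.
  rewrite /nbr_sum big_split -mulr_sumr -!/(nbr_sum _ _) /= xE yE.
  have : b * (sg * y u) <= b * x w.
    apply: ler_wpM2l => //; apply: le_trans (xw u).
    by apply: le_trans (sgy u); exact: ler_norm.
  lra.
have m1 : 0 <= mu - 1 by lra.
have m0 : 0 <= mu by lra.
have := ler_wpM2l m1 step; have := ler_wpM2l m0 IH.
rewrite !exprS -/sg; lra.
Qed.

(** The bound is the same for all eigenvalues [a], so it passes to the infimum of the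
    spectrum. *)
Lemma min_gap a : 1 < mu -> ~ bipartite_graph G -> @spectrum R G a ->
  2 * (mu - 1) <= (mu + a) * ((1 + mu) * mu ^+ (2 * diameter G) - 2).
Proof.
move=> mu1 nbip sa; have [_ a_ge] := spectrum_le sa.
have [y yE /(touching_scale x_gt0)[c [cy [p cyp]]]] := (spectrumP G a).1 sa.
have [w xw] := max_vertex x.
pose z j := c * y j.
have zE i : nbr_sum z i = ((mu + a) - mu) * z i.
  by rewrite /z nbr_sumZ yE addrAC subrr add0r mulrCA.
have b0 : 0 <= mu + a by lra.
have growth := walk_growth mu1 xw zE cy b0 cyp.
have [u [v [uv puv]]] := nonbipartite_level_edge p Gconn nbip.
have [s /and3P[ps /eqP su _] sz_s] := geodesicP p u Gconn.
have [t /and3P[pt /eqP tv _] sz_t] := geodesicP p v Gconn.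
have [q /and3P[vq /eqP qw _] sz_q] := geodesicP v w Gconn.
(* two walks from [p] to [w] whose lengths differ by one *)
have short_walk : path (@adj G) p (t ++ q) by rewrite cat_path pt tv vq.
have long_walk : path (@adj G) p (s ++ v :: q) by rewrite cat_path ps /= su uv vq.
have := growth _ short_walk; have := growth _ long_walk.
rewrite !last_cat /= tv qw !size_cat /= sz_s sz_t puv addnS !exprS mulN1r.
set l := (_ + _)%N; move=> h1 h2.
have lD : (l <= 2 * diameter G)%N.
  by rewrite mul2n -addnn leq_add ?sz_q ?dist_le_diameter.
have powD : mu ^+ l <= mu ^+ (2 * diameter G) by rewrite ler_weXn2l // ltW.
have bpow : (mu + a) * ((1 + mu) * mu ^+ l) <= (mu + a) * ((1 + mu) * mu ^+ (2 * diameter G)).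
  by rewrite ler_wpM2l // ler_wpM2l //; lra.
suff : 2 * (mu - 1) <= (mu + a) * ((1 + mu) * mu ^+ l - 2) by lra.
rewrite -(ler_pM2r (x_gt0 w)); lra.
Qed.

(** The vertex [w] where [x] is largest is reached from a vertex [u] of small degree;
    either [x u] is comparable to [x w], and the missing degree at [u] counts, or [x]
    varies along the path from [u] to [w]. *)
Lemma max_gap : ~ regular_graph G ->
  1 < ((max_degree G)%:R - mu) * (#|G|%:R * ((diameter G)%:R + 1)).
Proof.
move=> nreg; have [w xw] := max_vertex x.
have degD (i : G) : (degree i <= max_degree G)%N by exact: (leq_bigmax (F := @degree G)).
have [u uD] : exists u : G, (degree u < max_degree G)%N.
  apply: contrapT => no; apply: nreg; exists (max_degree G) => i.
  by apply/eqP; rewrite eqn_leq degD leqNgt; apply/negP => lt; apply: no; exists i.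
have [v xv] : exists v : G, x v < x w.
  apply: contrapT => no; apply: nreg; exists (degree w) => i.
  have xc j : x j = x w.
    by apply/eqP; rewrite eq_le xw leNgt; apply/negP => lt; apply: no; exists j.
  have dmu (j : G) : (degree j)%:R = mu.
    apply: (mulIf (negbT (gt_eqF (x_gt0 w)))).
    rewrite -{2}(xc j) -xE /nbr_sum /degree cardsE -sumr_const mulr_suml.
    by apply: eq_bigr => k _; rewrite mul1r xc.
  by apply/eqP; rewrite -(eqr_nat R) !dmu.
have [s /and3P[us /eqP sw uniq_s] sz_s] := geodesicP u w Gconn.
pose S := \sum_i x i ^+ 2; pose D : R := (diameter G)%:R.
have S_lt : S < #|G|%:R * x w ^+ 2.
  have -> : #|G|%:R * x w ^+ 2 = \sum_(i : G) x w ^+ 2 by rewrite mulr_natl -sumr_const.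
  rewrite /S (bigD1 v) //= [ltRHS](bigD1 v) //=.
  apply: ltr_leD; first by rewrite ltr_pXn2r ?nnegrE ?ltW.
  by apply: ler_sum => i _; rewrite ler_pXn2r ?nnegrE ?xw // ltW.
have gapE : ((max_degree G)%:R - mu) * S *+ 2 =
    (\sum_i ((max_degree G)%:R - (degree i)%:R) * x i ^+ 2) *+ 2
    + \sum_i \sum_(j | adj i j) (x i - x j) ^+ 2.
  rewrite degree_energy -mulrnDl -big_split mulr_sumr; congr (_ *+ 2).
  by apply: eq_bigr => i _ /=; rewrite xE; ring.
have loss : x u ^+ 2 <= \sum_i ((max_degree G)%:R - (degree i)%:R) * x i ^+ 2.
  rewrite (bigD1 u) //=; apply: ler_wpDr.
    by apply: sumr_ge0 => i _; rewrite mulr_ge0 ?sqr_ge0 // subr_ge0 ler_nat.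
  by rewrite ler_peMl ?sqr_ge0 // lerBrDl natr1 ler_nat.
have := path_energy x us; rewrite sw.
have := edge_energy_uniq x uniq_s; have := edge_energy_ge0 x (u :: s).
set e := edge_energy _ _; set E := \sum_i \sum_(j | _) _ in gapE * => e0 eE.
have sD : (size s)%:R <= D by rewrite ler_nat sz_s dist_le_diameter.
have D0 : 0 <= D by exact: ler0n.
move=> /le_trans/(_ (ler_wpM2r e0 sD))/le_trans/(_ (ler_wpM2l D0 eE)) path_le.
have E0 : 0 <= E by lra.
(* Cauchy-Schwarz for [x w = x u + (x w - x u)] with weights 1 and [D] *)
have cauchy : x w ^+ 2 *+ 2 <= (D + 1) * (x u ^+ 2 *+ 2 + E).
  have [D1|] := leP 1 D.
    have : 0 <= D^-1 * (x u * D - (x w - x u)) ^+ 2.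
      by rewrite mulr_ge0 ?sqr_ge0 ?invr_ge0.
    have -> : D^-1 * (x u * D - (x w - x u)) ^+ 2 = D * x u ^+ 2
        - 2 * x u * (x w - x u) + D^-1 * (x u - x w) ^+ 2 by field; lra.
    have : D^-1 * ((x u - x w) ^+ 2 *+ 2) <= E by rewrite ler_pdivrMl //; lra.
    lra.
  rewrite /D ltrn1 ltnS leqn0 => /eqP D00; move: path_le; rewrite /D D00 mul0r => h.
  have /eqP : (x u - x w) ^+ 2 = 0 by apply/eqP; rewrite eq_le sqr_ge0 andbT; lra.
  rewrite sqrf_eq0 subr_eq0 => /eqP ->; lra.
have gap_S : x w ^+ 2 <= (D + 1) * (((max_degree G)%:R - mu) * S).
  have : (D + 1) * (x u ^+ 2 *+ 2 + E) <= (D + 1) * (((max_degree G)%:R - mu) * S *+ 2).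
    by rewrite ler_wpM2l //; lra.
  lra.
have xw2 : 0 < x w ^+ 2 by rewrite exprn_gt0.
have gap0 : 0 < (max_degree G)%:R - mu.
  rewrite ltNge; apply/negP => le0; have : 0 < (D + 1) * (((max_degree G)%:R - mu) * S) by lra.
  apply/negP; rewrite -leNgt mulr_ge0_le0 ?mulr_le0_ge0 //; first by lra.
  by apply: sumr_ge0 => i _; exact: sqr_ge0.
rewrite -(ltr_pM2r xw2) mul1r; apply: le_lt_trans gap_S _.
have : ((max_degree G)%:R - mu) * (D + 1) * S
    < ((max_degree G)%:R - mu) * (D + 1) * (#|G|%:R * x w ^+ 2).
  by rewrite ltr_pM2l // mulr_gt0 //; lra.
rewrite -/D; lra.
Qed.

End PositiveEigenvector.

(** * The two gaps combined *)

Lemma nonregular_max_degree (G : sgraph) : connected_graph G -> ~ regular_graph G ->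
  (2 <= max_degree G)%N.
Proof.
move=> conn nreg; rewrite leqNgt; apply/negP => Delta1; apply: nreg.
have deg1 (i : G) : (degree i <= 1)%N.
  by rewrite -ltnS; apply: leq_ltn_trans Delta1; exact: (leq_bigmax (F := @degree G)).
have [i0] := vertex_inhabited G.
exists (degree i0) => i; have [-> //|ne] := eqVneq i i0.
have deg_gt0 (k l : G) : k != l -> (0 < degree k)%N.
  move=> kl; have [[|m p] /and3P[]] := conn k l; first by rewrite /= (negPf kl).
  by move=> /andP[km _] _ _; apply/card_gt0P; exists m; rewrite inE.
have di : degree i = 1%N by apply/eqP; rewrite eqn_leq deg1 (deg_gt0 _ _ ne).
rewrite di; apply/esym/eqP; rewrite eqn_leq deg1 (deg_gt0 i0 i) //; by rewrite eq_sym.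
Qed.

Lemma degree_lt_order (G : sgraph) (i : G) : (degree i < #|G|)%N.
Proof.
rewrite -cardsT; apply: proper_card; rewrite properT.
by apply/eqP => /setP/(_ i); rewrite !inE adj_irr.
Qed.

Theorem theorem6 (R : realType) (G : sgraph)
    (Gconn : connected_graph G) (Gnreg : ~ regular_graph G) (Gnbip : ~ bipartite_graph G) :
  (max_degree G)%:R + mu_min R G >
    1 / (#|G|%:R * ((diameter G)%:R + 1))
    + 1 / (mu_max R G ^+ (2 * diameter G) * #|G|%:R).
Proof.
have [mu [x [x_gt0 xE]]] := perron R Gconn.
have n_gt0 : 0 < #|G|%:R :> R by rewrite ltr0n; exact: vertex_gt0.
have D0 : 0 <= (diameter G)%:R :> R by exact: ler0n.
have Delta2 := nonregular_max_degree Gconn Gnreg.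
have [i0] := vertex_inhabited G.
have [d dmax] : exists d : G, max_degree G = degree d.
  by rewrite /max_degree; have [d ->] := bigop.eq_bigmax (@degree G) (vertex_gt0 G); exists d.
have n3 : 3 <= #|G|%:R :> R.
  by rewrite (ler_nat _ 3) (leq_ltn_trans Delta2) // dmax degree_lt_order.
have mu2 : 2 <= mu ^+ 2.
  by apply: le_trans (degree_le_sqr x_gt0 xE d); rewrite -dmax (ler_nat _ 2).
rewrite (mu_maxE x_gt0 xE).
have mu0 : 0 <= mu.
  by rewrite -(pmulr_lge0 _ (x_gt0 i0)) -xE; apply: sumr_ge0 => j _; exact: ltW.
(* with [n >= 3], the final comparison needs [5 * mu >= 7], and [(7 / 5)^2 < 2] *)
have mu14 : 14 / 10 <= mu by move: mu2; rewrite expr2; nra.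
have mu1 : 1 < mu by lra.
have gap1 : 1 / (#|G|%:R * ((diameter G)%:R + 1)) < (max_degree G)%:R - mu.
  rewrite ltr_pdivrMr; first exact: max_gap.
  by rewrite mulr_gt0 //; lra.
set M := mu ^+ (2 * diameter G).
have M1 : 1 <= M by rewrite exprn_ege1 // ltW.
pose K := (1 + mu) * M - 2.
have K0 : 0 < K.
  have := ler_wpM2l (_ : 0 <= 1 + mu) M1; rewrite /K; lra.
have min_ge : 2 * (mu - 1) / K <= mu + mu_min R G.
  rewrite -lerBlDl; apply: lb_le_inf.
    exists mu; apply/spectrumP; exists x => //; exists i0; by rewrite gt_eqF.
  by move=> a /(min_gap Gconn x_gt0 xE mu1 Gnbip) h; rewrite lerBlDl ler_pdivrMr.
have gap2 : 1 / (M * #|G|%:R) < 2 * (mu - 1) / K.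
  rewrite ltr_pdivrMr; last by rewrite mulr_gt0 //; lra.
  rewrite mulrAC ltr_pdivlMr // mul1r /K.
  have M0 : 0 <= 2 * (mu - 1) * M by rewrite !mulr_ge0 //; lra.
  have := ler_wpM2l M0 n3.
  have : 0 <= (5 * mu - 7) * M by rewrite mulr_ge0 //; lra.
  lra.
lra.
Qed.
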